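(* Let $f\colon\mathbb{R}\to\mathbb{R}$ be a continuous $T$-periodic function and let $\alpha\in(0,1)$. If the fractional integral $I^\alpha f$ is a bounded function, then $I^\alpha f$ is not an almost periodic function.
   Context: For $\alpha>0$, the fractional integral of order $\alpha$ of a function $f\colon\mathbb{R}\to\mathbb{R}$ is $I^\alpha f(t)=\dfrac{1}{\Gamma(\alpha)}\displaystyle\int_0^t (t-s)^{\alpha-1}f(s)\,ds$ for $t>0$. A set $E\subset\mathbb{R}$ is relatively dense if there exists a number $l>0$ such that any interval of length $l$ contains at least one number of $E$. A continuous function $g\colon\mathbb{R}\to\mathbb{R}$ is almost periodic if for every $\varepsilon>0$ there exists a relatively dense subset $\mathscr{H}(\varepsilon,g)$ of $\mathbb{R}$ such that $|g(t+\xi)-g(t)|<\varepsilon$ for every $t\in\mathbb{R}$ and all $\xi\in\mathscr{H}(\varepsilon,g)$.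
   Formalization: The function f is additionally assumed not to be identically zero: for f = 0 the fractional integral is 0, which is bounded and almost periodic, so the statement fails there. *)

(* Defs.v *)
From mathcomp Require Import all_boot all_order all_algebra.
From mathcomp Require Import all_classical all_reals all_analysis.
Set Implicit Arguments.
Unset Strict Implicit.
Unset Printing Implicit Defensive.
Import Order.TTheory GRing.Theory Num.Theory.
Import numFieldNormedType.Exports.
Local Open Scope classical_set_scope.
Local Open Scope ring_scope.

(* Euler's integral; only meaningful for 0 < a. *)
Definition Gamma (R : realType) (a : R) : R :=
  \int[lebesgue_measure]_(x in `]0, +oo[) (x `^ (a - 1) * expR (- x)).

(* Only meaningful for 0 < a and 0 < t. The value of the kernel at the
   endpoint s = t is irrelevant, {t} being Lebesgue-negligible. *)
Definition frac_int (R : realType) (a : R) (f : R -> R) (t : R) : R :=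
  (Gamma a)^-1 *
  \int[lebesgue_measure]_(s in `[0, t]) ((t - s) `^ (a - 1) * f s).

Definition relatively_dense (R : realType) (E : set R) : Prop :=
  exists2 l : R, 0 < l & forall a : R, `[a, a + l] `&` E !=set0.

Definition almost_periodic (R : realType) (g : R -> R) : Prop :=
  continuous g /\
  forall eps : R, 0 < eps ->
    exists2 H : set R, relatively_dense H &
      forall t xi : R, H xi -> `|g (t + xi) - g t| < eps.

(* Main.v *)
Require Import Defs.
From mathcomp Require Import all_boot all_order all_algebra.
From mathcomp Require Import all_classical all_reals all_analysis.
From mathcomp Require Import measurable_realfun ring lra.
Set Implicit Arguments.
Unset Strict Implicit.
Unset Printing Implicit Defensive.
Import Order.TTheory GRing.Theory Num.Theory.
Import numFieldNormedType.Exports.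
Local Open Scope classical_set_scope.
Local Open Scope ring_scope.

(** Write [F] for the fractional integral of [f], and suppose that an almost
    periodic [g] extends it.  Splitting the integral at [T] and using the
    periodicity of [f],

      Gamma(alpha) * (F(t + T) - F(t))
        = integral over [0, T] of (t + T - s)^(alpha - 1) f(s) ds

    ([frac_int_shiftB]).  Since [alpha < 1], the right-hand side tends to 0 as
    [t] grows ([frac_int_shiftB_small]), hence so does [g (t + T) - g t].  This
    difference inherits almost periodicity from [g], and an almost periodic
    function that vanishes at infinity is zero ([almost_periodic_shift_eq]).
    As [Gamma alpha] is a nonzero number ([Gamma_gt0]), it follows that

      integral over [0, T] of (x - s)^(alpha - 1) f(s) ds = 0  for all x > T.

    This forces [f = 0] on [0, T] ([kernel_integral0_eq0]).  Differentiating in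
    [x] produces the same identity with exponent [alpha - 1 - n] for every [n]
    ([kernel_integral0_lower]).  By linearity, for a fixed [x], the weighted
    function (x - s)^(alpha - 1) f(s) is orthogonal to every polynomial in
    [(x - s)^-1] ([kernel_integral0_poly]).  If [f] were positive on some
    interval, one could choose such a polynomial [q] with values in [0, 1] off
    that interval and larger than 1 inside it ([bump_peak]); the integrals of
    its powers against the weighted function would then be unbounded
    ([peak_integral_neq0]), a contradiction.  The same argument applies to
    [- f], so [f] vanishes on a period, hence everywhere. *)

(** * Almost periodicity *)

(** An almost period carries any point arbitrarily far to the right without
    changing [g] by much, so what [g] does near [+oo] it does everywhere: a
    shift difference that vanishes at [+oo] is identically zero. *)
Lemma almost_periodic_shift_eq (R : realType) (g : R -> R) (T : R) :
  almost_periodic g ->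
  (forall eps : R, 0 < eps ->
    exists M : R, forall t : R, M <= t -> `|g (t + T) - g t| < eps) ->
  forall t : R, g (t + T) = g t.
Proof.
move=> [_ apg] gT t; apply/eqP; rewrite -subr_eq0 -normr_le0.
apply/ler_addgt0Pr => e e0; rewrite add0r.
have e3 : 0 < e / 3 by rewrite divr_gt0.
have [H [l l0 Hl] Hg] := apg _ e3.
have [M gM] := gT _ e3.
have [xi [/=]] := Hl (M - t); rewrite in_itv/= => /andP[Mxi _] Hxi.
have Mt : M <= t + xi by rewrite addrC -lerBlDr.
have h1 := gM _ Mt; have h2 := Hg t xi Hxi; have h3 := Hg (t + T) xi Hxi.
have -> : g (t + T) - g t = (g (t + xi + T) - g (t + xi))
  - (g (t + T + xi) - g (t + T)) + (g (t + xi) - g t).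
  by rewrite (addrAC t xi T); ring.
apply: (le_trans (ler_normD _ _)).
apply: (le_trans (lerD (ler_normB _ _) (lexx _))).
by lra.
Qed.

(** * Reflection invariance of the Lebesgue integral *)

Section reflection.
Context {R : realType}.
Local Notation mu := (@lebesgue_measure R).
Local Notation reflect c :=
  (fun x : measurableTypeR R => c - x : measurableTypeR R).
Implicit Types (a b c : R) (h : R -> R).

Let measurable_reflect c :
  measurable_fun setT (reflect c).
Proof.
by apply: continuous_measurable_fun => x; apply: cvgB => //; exact: cvg_cst.
Qed.

Lemma lebesgue_measure_reflect c (A : set R) : measurable A ->
  pushforward mu (reflect c) A
    = mu A.
Proof.
move=> mA; apply/esym.
apply: (lebesgue_measure_unique (mu := pushforward mu (reflect c))) => //=.
move=> _ [[a b]] _ <-.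
rewrite /pushforward.
rewrite (_ : _ @^-1` _ = `[c - b, c - a[%classic).
  rewrite !lebesgue_measure_itv/= !lte_fin ltrD2l ltrN2 -!EFinB.
  by case: ifPn => // _; congr (_%:E); ring.
apply/seteqP; split => x /=; rewrite !in_itv/= => /andP[? ?];
  by apply/andP; split; lra.
Qed.

Let reflect_preimage_itvcc c a b :
  (reflect c)
    @^-1` `[c - b, c - a]%classic = `[a, b]%classic.
Proof.
by apply/seteqP; split => x /=; rewrite !in_itv/= => /andP[? ?];
  by apply/andP; split; lra.
Qed.

Lemma integrable_reflect c h a b : measurable_fun setT h ->
  mu.-integrable `[a, b] (fun x => (h (c - x))%:E) ->
  mu.-integrable `[c - b, c - a] (EFin \o h).
Proof.
move=> mh ih.
have /integrableP[mh' hoo] :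
    (pushforward mu (reflect c)).-integrable `[c - b, c - a] (EFin \o h).
  apply: integrable_pushforward => //; first exact/measurable_EFinP.
  by rewrite reflect_preimage_itvcc.
apply/integrableP; split => //.
rewrite (eq_measure_integral (pushforward mu (reflect c)))//.
by move=> A mA _; exact/esym/lebesgue_measure_reflect.
Qed.

Lemma Rintegral_reflect c h a b : measurable_fun setT h ->
  mu.-integrable `[a, b] (fun x => (h (c - x))%:E) ->
  \int[mu]_(x in `[a, b]) h (c - x) = \int[mu]_(x in `[c - b, c - a]) h x.
Proof.
move=> mh ih; rewrite /Rintegral; congr fine.
have := integral_pushforward (measurable_reflect c) (f := EFin \o h)
  (mu := mu) (D := `[c - b, c - a]).
rewrite reflect_preimage_itvcc => <- //; last exact/measurable_EFinP.
by apply: eq_measure_integral => //= A mA _; exact: lebesgue_measure_reflect.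
Qed.

End reflection.

(** * The singular power kernel and the Gamma function *)

Section power_kernel.
Context {R : realType}.
Local Notation mu := (@lebesgue_measure R).
Implicit Types (a b c t x : R).

Lemma continuous_at_powR (b x : R) : 0 < x ->
  {for x, continuous (fun y : R => y `^ b)}.
Proof.
move=> x0; apply: differentiable_continuous; apply/derivable1_diffP.
by apply: derivable_powR; rewrite in_itv/= x0.
Qed.

(** The bound does not depend on the left end point [c], which lets [c] tend to
    the singularity at 0. *)
Lemma integral_powR_le a c t : 0 < a -> 0 < c -> c < t ->
  (\int[mu]_(x in `[c, t]) (x `^ (a - 1))%:E <= (t `^ a / a)%:E)%E.
Proof.
move=> a0 c0 ct.
rewrite (@continuous_FTC2 _ (fun x => x `^ (a - 1)) (fun x => a^-1 * x `^ a))//.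
- rewrite -EFinB lee_fin [leRHS]mulrC lerBlDr lerDl.
  by rewrite mulr_ge0// ?invr_ge0 ?powR_ge0// ltW.
- apply: continuous_in_subspaceT => x; rewrite inE/= in_itv/= => /andP[cx _].
  exact/continuous_at_powR/(lt_le_trans c0).
- have cpow x : 0 < x -> (fun x => a^-1 * x `^ a) y @[y --> x] --> a^-1 * x `^ a.
    by move=> x0; apply: cvgMr; exact: continuous_at_powR.
  split.
  + move=> x; rewrite in_itv/= => /andP[cx _].
    apply: derivableM; first exact: derivable_cst.
    by apply: derivable_powR; rewrite in_itv/= andbT; exact: lt_trans cx.
  + by apply: cvg_at_right_filter; exact: cpow.
  + by apply: cvg_at_left_filter; apply: cpow; exact: lt_trans ct.
- move=> x; rewrite in_itv/= => /andP[cx _]; have x0 := lt_trans c0 cx.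
  rewrite derive1Ml; last by apply: derivable_powR; rewrite in_itv/= x0.
  rewrite powR_derive1; last by rewrite in_itv/= x0.
  by rewrite mulrA mulVf ?mul1r// gt_eqF.
Qed.

Lemma integrable_powR a t : 0 < a -> 0 < t ->
  mu.-integrable `[0, t] (fun x => (x `^ (a - 1))%:E).
Proof.
move=> a0 t0.
have mpow : measurable_fun setT (fun x : R => (x `^ (a - 1))%:E).
  by apply/measurable_EFinP; exact: measurable_powR.
apply/integrableP; split; first exact: measurable_funTS.
under eq_integral do rewrite gee0_abs ?lee_fin ?powR_ge0//.
rewrite -integral_itv_obnd_cbnd; last exact: measurable_funTS.
(* The intervals start at t / n.+2 so as to be nondegenerate for n = 0. *)
pose F n := `[t / n.+2%:R, t]%classic.
have -> : `]0, t]%classic = \bigcup_i F i.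
  apply/seteqP; split => x /=; rewrite in_itv/=.
    move=> /andP[x0 xt].
    have [n nx] : exists n : nat, t / x < n%:R.
      exists (Num.bound (t / x)); apply: le_lt_trans (archi_boundP _) => //.
      by rewrite divr_ge0// ltW.
    exists n => //; rewrite /F/= in_itv/= xt andbT.
    rewrite ler_pdivrMr// mulrC -ler_pdivrMr//.
    by rewrite (le_trans (ltW nx))// ler_nat ltnW// ltnW.
  move=> [n _]; rewrite /F/= in_itv/= => /andP[tx ->].
  by rewrite andbT (lt_le_trans _ tx)// divr_gt0.
have ndF : nondecreasing_seq F.
  apply/nondecreasing_seqP => n; apply/subsetPset => x.
  rewrite /F/= !in_itv/= => /andP[tx ->].
  by rewrite andbT (le_trans _ tx)// ler_pM2l// lef_pV2 ?posrE// ler_nat.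
have mF i : measurable (F i) by exact: measurable_itv.
have mpowF i : measurable_fun (F i) (fun x : R => (x `^ (a - 1))%:E).
  exact: measurable_funTS.
have pow_ge0 i x : F i x -> (0 <= (x `^ (a - 1))%:E)%E.
  by move=> _; rewrite lee_fin powR_ge0.
have /cvg_lim <-// :=
  ge0_nondecreasing_set_cvg_integral (mu := mu) ndF mF mpowF pow_ge0.
apply: (@le_lt_trans _ _ (t `^ a / a)%:E); last exact: ltry.
apply: lime_le.
  apply: ereal_nondecreasing_is_cvgn.
  exact: ge0_nondecreasing_set_nondecreasing_integral.
apply: nearW => n; apply: integral_powR_le => //; first exact: divr_gt0.
by rewrite ltr_pdivrMr// ltr_pMr// ltr1n.
Qed.

(** A real-valued integral is 0 when it diverges, so positivity also needs the
    convergence of Euler's integral: its integrand lies below [x `^ (a - 1)] on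
    [0, 1] and below [expR (- x)] beyond 1. *)
Lemma Gamma_gt0 a : 0 < a -> a < 1 -> 0 < Gamma a.
Proof.
move=> a0 a1.
pose k (x : R) := x `^ (a - 1) * expR (- x).
have k_ge0 x : 0 <= k x by rewrite mulr_ge0 ?powR_ge0 ?expR_ge0.
have mexp : measurable_fun setT (fun x : R => expR (- x)).
  apply: continuous_measurable_fun => x.
  by apply: continuous_comp; [exact: cvgN|exact: continuous_expR].
have mk : measurable_fun setT k.
  by apply: measurable_funM => //; exact: measurable_powR.
pose p := (fun x : R => (x `^ (a - 1))%:E) \_ `[0, 1].
pose q := EFin \o @exponential_pdf R 1.
have ik : mu.-integrable `]0, +oo[ (EFin \o k).
  have mI : measurable (`]0, +oo[ : set R) by exact: measurable_itv.
  apply: (@le_integrable _ _ _ mu _ mI (EFin \o k) (p \+ q)%E).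
  - exact/measurable_EFinP/measurable_funTS.
  - have p0 x : (0 <= p x)%E.
      by rewrite /p patchE; case: ifPn => // _; rewrite lee_fin powR_ge0.
    have q0 x : (0 <= q x)%E by rewrite lee_fin exponential_pdf_ge0.
    move=> x; rewrite /= in_itv/= andbT => x0.
    rewrite ger0_norm// gee0_abs ?adde_ge0//.
    have [x1|x1] := leP x 1.
      apply: (@le_trans _ _ (p x)); last by rewrite leeDl.
      rewrite /p patchE mem_set/= ?in_itv/= ?x1 ?(ltW x0)// lee_fin /k.
      by rewrite ler_piMr ?powR_ge0// -expR0 ler_expR oppr_le0 ltW.
    apply: (@le_trans _ _ (q x)); last by rewrite leeDr.
    rewrite /q/= exponential_pdfE ?(ltW x0)// lee_fin mulN1r mul1r /k.
    rewrite ler_piMl ?expR_ge0// -[leRHS](powRr0 x) ler_powR ?(ltW x1)//.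
    by rewrite subr_le0 ltW.
  - apply: (@integrableS _ _ _ _ setT) => //; apply: integrableD => //.
      by apply/integrable_restrict => //=; rewrite setTI; exact: integrable_powR.
    exact: integrable_exponential_pdf.
rewrite /Gamma /Rintegral fine_gt0//; apply/andP; split; last first.
  by have := integrable_lty _ ik; apply.
have e1 : 0 < expR (-1 : R) by exact: expR_gt0.
apply: (@lt_le_trans _ _ (\int[mu]_(x in `]0%R, 1%R]) (expR (-1))%:E)%E).
  by rewrite integral_cst//= lebesgue_measure_itv/= lte_fin ltr01 sube0 mule1 lte_fin.
apply: (@le_trans _ _ (\int[mu]_(x in `]0%R, 1%R]) (k x)%:E)%E).
  apply: ge0_le_integral => //.
  - exact/measurable_EFinP/measurable_funTS.
  - move=> x; rewrite /= in_itv/= => /andP[x0 x1]; rewrite lee_fin.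
    apply: (@le_trans _ _ (expR (- x))); first by rewrite ler_expR lerN2.
    rewrite ler_peMl ?expR_ge0// -[leLHS](powRr0 x) ger_powR ?x0//.
    by rewrite subr_le0 ltW.
apply: ge0_subset_integral => //.
- exact/measurable_EFinP/measurable_funTS.
- by move=> x _; rewrite lee_fin.
- by move=> x /=; rewrite !in_itv/= andbT => /andP[].
Qed.

Lemma integrable_powR_reflect a t : 0 < a -> 0 < t ->
  mu.-integrable `[0, t] (fun s => ((t - s) `^ (a - 1))%:E).
Proof.
move=> a0 t0.
have mpow : measurable_fun setT (fun s : R => (t - s) `^ (a - 1)).
  apply: (measurableT_comp (f := fun x : R => x `^ (a - 1))).
    exact: measurable_powR.
  exact: measurable_funB.
have := @integrable_reflect R t (fun s : R => (t - s) `^ (a - 1)) 0 t mpow.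
rewrite subrr subr0; apply.
have -> : (fun s : R => ((t - (t - s)) `^ (a - 1))%:E) =
    (fun s : R => (s `^ (a - 1))%:E).
  by apply/funext => s; rewrite subKr.
exact: integrable_powR.
Qed.

End power_kernel.

(** * The difference of two translates of the fractional integral *)

Section shifted_kernel.
Context {R : realType}.
Local Notation mu := (@lebesgue_measure R).
Implicit Types (a b t x : R) (f : R -> R).

Lemma segment_bounded a b f : {within `[a, b], continuous f} ->
  exists2 M, 0 <= M & forall x, x \in `[a, b] -> `|f x| <= M.
Proof.
move=> cf.
have [M [_ Mf]] :=
  compact_bounded (continuous_compact cf (@segment_compact R a b)).
exists (`|M| + 1); first by rewrite addr_ge0.
move=> x xab; apply: (Mf (`|M| + 1)); last by exists x.
by rewrite (le_lt_trans (ler_norm _))// ltrDl.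
Qed.

Lemma integrable_singular_kernel a t f : 0 < a -> 0 < t -> continuous f ->
  mu.-integrable `[0, t] (fun s => ((t - s) `^ (a - 1) * f s)%:E).
Proof.
move=> a0 t0 cf.
have := @integrableMl _ _ _ mu `[0, t]%classic (measurable_itv _) _ f
  (integrable_powR_reflect a0 t0).
apply; first by apply: measurable_funTS; exact: continuous_measurable_fun.
have cf0t : {within `[0, t], continuous f} by exact: continuous_subspaceT.
have [M _ Mf] := segment_bounded cf0t.
exists M; split => [|y My x xt]; first exact: num_real.
exact: le_trans (Mf x xt) (ltW My).
Qed.

Lemma within_continuous_kernel a b x (beta : R) f : b < x -> continuous f ->
  {within `[a, b], continuous (fun s => (x - s) `^ beta * f s)}.
Proof.
move=> bx cf; apply: continuous_in_subspaceT => s.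
rewrite inE/= in_itv/= => /andP[_ sb].
apply: cvgM; last exact: cf.
apply: (@continuous_comp _ _ _ (fun s => x - s) (fun y => y `^ beta)).
  by apply: cvgB => //; exact: cvg_cst.
by apply: continuous_at_powR; rewrite subr_gt0 (le_lt_trans sb).
Qed.

Lemma integrable_kernel a b x (beta : R) f : b < x -> continuous f ->
  mu.-integrable `[a, b] (fun s => ((x - s) `^ beta * f s)%:E).
Proof.
move=> bx cf.
have := @continuous_compact_integrable R (fun s => (x - s) `^ beta * f s)
  `[a, b]%classic (@segment_compact R a b).
by apply; exact: within_continuous_kernel.
Qed.

(** In the coordinate [u = t - s] the kernel no longer depends on [t], and
    periodicity makes the integrands for [t] and [t + T] coincide.  The
    difference is therefore an integral over the single period
    [t <= u <= t + T], where the kernel is not singular. *)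
Lemma frac_int_shiftB f (T a t : R) : continuous f -> 0 < T -> periodic f T ->
  0 < a -> 0 < t ->
  frac_int a f (t + T) - frac_int a f t =
  (Gamma a)^-1 * \int[mu]_(s in `[0, T]) ((t + T - s) `^ (a - 1) * f s).
Proof.
move=> cf T0 fT a0 t0.
have fNT x : f (x - T) = f x by rewrite -[in RHS](subrK T x) fT.
pose h u := u `^ (a - 1) * f (t - u).
have mh : measurable_fun setT h.
  apply: measurable_funM; first exact: measurable_powR.
  apply: (measurableT_comp (f := f)); first exact: continuous_measurable_fun.
  exact: measurable_funB.
have hE s : h (t - s) = (t - s) `^ (a - 1) * f s by rewrite /h subKr.
have hTE s : h (t + T - s) = (t + T - s) `^ (a - 1) * f s.
  by rewrite /h (_ : t - _ = s - T) ?fNT//; ring.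
have hEE : (fun s => (h (t - s))%:E)
    = (fun s => ((t - s) `^ (a - 1) * f s)%:E) by apply/funext => s; rewrite hE.
have hTEE : (fun s => (h (t + T - s))%:E)
    = (fun s => ((t + T - s) `^ (a - 1) * f s)%:E).
  by apply/funext => s; rewrite hTE.
have tT0 : 0 < t + T by exact: addr_gt0.
have iht : mu.-integrable `[0, t] (fun s => (h (t - s))%:E).
  by rewrite hEE; exact: integrable_singular_kernel.
have ihtT : mu.-integrable `[0, t + T] (fun s => (h (t + T - s))%:E).
  by rewrite hTEE; exact: integrable_singular_kernel.
have ihT : mu.-integrable `[0, T] (fun s => (h (t + T - s))%:E).
  by rewrite hTEE; apply: integrable_kernel => //; rewrite ltrDr.
have ih : mu.-integrable `[0, t + T] (EFin \o h).
  by have := integrable_reflect mh ihtT; rewrite subrr subr0.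
rewrite /frac_int -mulrBr; congr (_ * _).
under eq_Rintegral do rewrite -hTE.
under [X in _ - X]eq_Rintegral do rewrite -hE.
under [RHS]eq_Rintegral do rewrite -hTE.
rewrite !Rintegral_reflect// !subrr !subr0 addrK.
rewrite Rintegral_itvB//; last 2 first.
- by rewrite bnd_simp ltW.
- by rewrite bnd_simp lerDl ltW.
rewrite Rintegral_itv_obnd_cbnd//.
apply: integrableS ih => //; apply: subset_itvr.
by rewrite bnd_simp ltW.
Qed.

Lemma powR_anti (beta x y : R) : beta <= 0 -> 0 < x -> x <= y ->
  y `^ beta <= x `^ beta.
Proof.
move=> b0 x0 xy; have y0 := lt_le_trans x0 xy.
rewrite -(opprK beta) (powRN y) (powRN x) lef_pV2 ?posrE ?powR_gt0//.
by apply: ge0_ler_powR; rewrite ?oppr_ge0// nnegrE ltW.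
Qed.

(** Over one period the kernel of [frac_int_shiftB] is at most [t `^ (a - 1)],
    which tends to 0 since [a < 1]. *)
Lemma frac_int_shiftB_small f (T a : R) : continuous f -> 0 < T ->
  periodic f T -> 0 < a -> a < 1 -> forall eps, 0 < eps ->
  exists M, forall t, M <= t -> `|frac_int a f (t + T) - frac_int a f t| < eps.
Proof.
move=> cf T0 fT a0 a1 eps eps0.
have cf0T : {within `[0, T], continuous f} by exact: continuous_subspaceT.
have [K K0 fK] := segment_bounded cf0T.
have G0 := Gamma_gt0 a0 a1.
(* The threshold solves t `^ (1 - a) = A, where the bound
   (Gamma a)^-1 * t `^ (a - 1) * K * T drops below eps. *)
pose A := (Gamma a)^-1 * (K * T) / eps + 1.
have A0 : 0 < A by rewrite ltr_wpDl// !mulr_ge0 ?invr_ge0 ?(ltW T0) ?(ltW G0) ?(ltW eps0).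
exists (A `^ (1 - a)^-1) => t At.
have t0 : 0 < t by rewrite (lt_le_trans _ At)// powR_gt0.
rewrite frac_int_shiftB// normrM ger0_norm ?invr_ge0 ?(ltW G0)//.
have ik : mu.-integrable `[0, T] (fun s => ((t + T - s) `^ (a - 1) * f s)%:E).
  by apply: integrable_kernel => //; rewrite ltrDr.
have icst : mu.-integrable `[0, T] (fun s => (t `^ (a - 1) * K)%:E).
  by apply: continuous_compact_integrable;
    [exact: segment_compact|apply: continuous_subspaceT => ?; exact: cvg_cst].
have bound : `|\int[mu]_(s in `[0, T]) ((t + T - s) `^ (a - 1) * f s)|
    <= t `^ (a - 1) * K * T.
  apply: (le_trans (le_normr_Rintegral _ ik)) => //.
  have -> : t `^ (a - 1) * K * T = \int[mu]_(s in `[0, T]) (t `^ (a - 1) * K).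
    by rewrite Rintegral_cst//= lebesgue_measure_itv/= lte_fin T0 sube0.
  apply: le_Rintegral => //.
    exact: (integrable_norm ik).
  move=> s /= sT.
  rewrite normrM ger0_norm ?powR_ge0// ler_pM ?powR_ge0//; last exact: fK.
  move: sT; rewrite in_itv/= => /andP[s0 sT].
  by apply: powR_anti => //; lra.
apply: (le_lt_trans (ler_wpM2l _ bound)); first by rewrite invr_ge0 ltW.
have tA : A <= t `^ (1 - a).
  have -> : A = (A `^ (1 - a)^-1) `^ (1 - a).
    by rewrite -powRrM mulVf ?powRr1 ?(ltW A0)// gt_eqF// subr_gt0.
  by apply: ge0_ler_powR; rewrite ?subr_ge0 ?nnegrE ?powR_ge0 ?(ltW a1) ?(ltW t0).
have -> : t `^ (a - 1) = (t `^ (1 - a))^-1 by rewrite -powRN opprB.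
rewrite (_ : _ * _ = ((Gamma a)^-1 * (K * T)) / (t `^ (1 - a))); last by ring.
rewrite ltr_pdivrMr ?powR_gt0// [ltRHS]mulrC -ltr_pdivrMr// (lt_le_trans _ tA)//.
by rewrite ltrDl.
Qed.

End shifted_kernel.

(** * Integrals against powers of the kernel *)

Section moments.
Context {R : realType}.
Local Notation mu := (@lebesgue_measure R).
Implicit Types (a b c d x beta : R) (f q psi : R -> R).

Lemma is_derive_kernel beta x (s : R) : s < x ->
  is_derive x 1 (fun y : R => (y - s) `^ beta) (beta * (x - s) `^ (beta - 1)).
Proof.
move=> sx; rewrite -[X in is_derive _ _ _ X]mulr1.
apply: (@is_derive1_comp R (fun y => y `^ beta) (shift (- s))).
  by apply: is_derive1_powR; rewrite subr_gt0.
exact: is_derive_shift.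
Qed.

(** Differentiating the vanishing identity in [x] under the integral sign
    lowers the exponent by one. *)
Lemma kernel_integral0_lower a b beta f : beta < 0 -> continuous f ->
  (forall x, b < x -> \int[mu]_(s in `[a, b]) ((x - s) `^ beta * f s) = 0) ->
  forall x, b < x -> \int[mu]_(s in `[a, b]) ((x - s) `^ (beta - 1) * f s) = 0.
Proof.
move=> beta0 cf int0 x bx.
pose k (y s : R) := (y - s) `^ beta * f s.
(* Staying to the right of the midpoint u keeps the kernel away from its
   singularity, uniformly in s. *)
pose u := (b + x) / 2.
have bu : b < u by rewrite /u; lra.
have xI : `]u, x + 1[%classic x by rewrite /= in_itv/= /u; apply/andP; split; lra.
have us y s : `]u, x + 1[%classic y -> `[a, b]%classic s -> s < y.
  rewrite /= !in_itv/= => /andP[uy _] /andP[_ sb].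
  by rewrite (le_lt_trans sb)// (lt_trans bu).
have dk (y s : R) : s < y ->
    is_derive y 1 (fun z : R => k z s) (beta * (y - s) `^ (beta - 1) * f s).
  move=> sy; rewrite [X in is_derive _ _ _ X]mulrC.
  have dks := is_derive_kernel beta sy.
  split; first by apply: derivableM => //; case: dks.
  by rewrite deriveMr; case: dks => // _ ->.
have cfab : {within `[a, b], continuous f} by exact: continuous_subspaceT.
have [M M0 fM] := segment_bounded cfab.
pose G (_ : R) := `|beta| * (u - b) `^ (beta - 1) * M.
have G0 y : 0 <= G y by rewrite !mulr_ge0 ?powR_ge0.
have intG : mu.-integrable `[a, b] (EFin \o G).
  by apply: continuous_compact_integrable;
    [exact: segment_compact|apply: continuous_subspaceT => ?; exact: cvg_cst].
have intk y : `]u, x + 1[%classic y -> mu.-integrable `[a, b] (EFin \o k y).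
  rewrite /= in_itv/= => /andP[uy _].
  by apply: integrable_kernel => //; exact: lt_trans uy.
have derk (y s : R) : `]u, x + 1[%classic y -> `[a, b]%classic s ->
    derivable (fun z : R => k z s) y 1.
  by move=> uy sab; case: (dk y s (us _ _ uy sab)).
have kG (y s : R) : `]u, x + 1[%classic y -> `[a, b]%classic s ->
    `|partial1of2 k y s| <= G s.
  move=> uy sab; have sy := us _ _ uy sab.
  rewrite partial1of2E; have [_ ->] := dk _ _ sy.
  rewrite !normrM /G ler_pM ?mulr_ge0//; last exact: fM.
  rewrite ler_wpM2l// ger0_norm ?powR_ge0//; apply: powR_anti.
  - by rewrite subr_le0 (le_trans (ltW beta0)).
  - by rewrite subr_gt0.
  - by move: uy sab; rewrite /= !in_itv/= => /andP[? _] /andP[_ ?]; lra.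
have := differentiation_under_integral (mu := mu) (measurable_itv _) xI
  intk derk G0 intG kG.
rewrite derive1E (@near_eq_derive _ _ _ _ (cst 0)); last first.
  near=> y; apply: int0; rewrite (lt_trans bu)//; near: y.
  by apply: lt_nbhsr; move: xI; rewrite /= in_itv/= => /andP[].
rewrite derive_cst => /esym.
rewrite (eq_Rintegral mu
  (g := fun s => beta * ((x - s) `^ (beta - 1) * f s))); last first.
  move=> s; rewrite inE/= => sab.
  by rewrite partial1of2E mulrA; have [_ ->] := dk _ _ (us _ _ xI sab).
rewrite RintegralZl//; last exact: integrable_kernel.
by move/eqP; rewrite mulf_eq0 lt_eqF//= => /eqP.
Unshelve. all: by end_near. Qed.

Lemma kernel_integral0_powers a b beta f : beta < 0 -> continuous f ->
  (forall x, b < x -> \int[mu]_(s in `[a, b]) ((x - s) `^ beta * f s) = 0) ->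
  forall n x, b < x ->
    \int[mu]_(s in `[a, b]) ((x - s) `^ (beta - n%:R) * f s) = 0.
Proof.
move=> beta0 cf int0; elim=> [|n ih] x bx.
  by under eq_Rintegral do rewrite subr0; exact: int0.
rewrite -natr1 opprD addrA; apply: kernel_integral0_lower => //.
by rewrite subr_lt0 (lt_le_trans beta0).
Qed.

(** Integrability is carried along because the induction on the polynomial
    splits the integral of a sum; [n] is free in the conclusion because the
    factor ['X] is absorbed into the exponent. *)
Lemma kernel_integral0_poly a b x beta f : b < x -> continuous f ->
  (forall n, \int[mu]_(s in `[a, b]) ((x - s) `^ (beta - n%:R) * f s) = 0) ->
  forall (P : {poly R}) n,
    mu.-integrable `[a, b]
      (fun s => (P.[(x - s)^-1] * ((x - s) `^ (beta - n%:R) * f s))%:E) /\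
    \int[mu]_(s in `[a, b]) (P.[(x - s)^-1] * ((x - s) `^ (beta - n%:R) * f s))
      = 0.
Proof.
move=> bx cf int0; elim/poly_ind => [|P c ih] n.
  split.
    rewrite (_ : (fun _ => _) = cst 0%E); first exact: integrable0.
    by apply/funext => s /=; rewrite horner0 mul0r.
  under eq_Rintegral do rewrite horner0 mul0r.
  by rewrite Rintegral_cst// mul0r.
have [iP intP] := ih n.+1.
have ik : mu.-integrable `[a, b]
    (fun s => (c * ((x - s) `^ (beta - n%:R) * f s))%:E).
  have := integrable_kernel a (beta - n%:R) bx cf.
  by move=> /(@integrableZl _ _ _ mu _ (measurable_itv _) c).
pose g s := P.[(x - s)^-1] * ((x - s) `^ (beta - n.+1%:R) * f s)
            + c * ((x - s) `^ (beta - n%:R) * f s).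
have gE s : s \in `[a, b]%classic ->
    (P * 'X + c%:P).[(x - s)^-1] * ((x - s) `^ (beta - n%:R) * f s) = g s.
  rewrite inE/= in_itv/= => /andP[_ sb].
  have xs : 0 < x - s by rewrite subr_gt0 (le_lt_trans sb).
  rewrite hornerMXaddC mulrDl; congr (_ + _).
  rewrite -natr1 opprD addrA [in RHS]powRB; last by apply/implyP => _; rewrite gt_eqF.
  by rewrite powRr1 ?ltW//; ring.
split.
  apply: (@eq_integrable _ _ _ mu _ _ (EFin \o g)) => //.
    by move=> s sab; rewrite /= gE.
  rewrite (_ : EFin \o g = (fun s =>
    (P.[(x - s)^-1] * ((x - s) `^ (beta - n.+1%:R) * f s))%:E +
    (c * ((x - s) `^ (beta - n%:R) * f s))%:E)%E)//.
  exact: integrableD.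
rewrite (eq_Rintegral mu (g := g))//.
rewrite RintegralD// intP RintegralZl//; last exact: integrable_kernel.
by rewrite int0 mulr0 addr0.
Qed.

(** The powers of [q] blow up on [c, d], where [psi] is bounded below, and stay
    at most 1 wherever [psi] may be negative.  The integrals thus tend to [+oo];
    Bernoulli's inequality gives a linear lower bound. *)
Lemma peak_integral_neq0 a b c d q psi (delta eta M : R) :
  a <= c -> c < d -> d <= b -> 0 < delta -> 0 < eta ->
  (forall s, s \in `[a, b] -> `|psi s| <= M) ->
  (forall s, s \in `[a, b] -> 0 <= q s) ->
  (forall s, s \in `[a, b] -> q s <= 1 \/ 0 <= psi s) ->
  (forall s, s \in `[c, d] -> 1 + eta <= q s /\ delta <= psi s) ->
  (forall n, mu.-integrable `[a, b] (fun s => (q s ^+ n * psi s)%:E)) ->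
  exists n, \int[mu]_(s in `[a, b]) (q s ^+ n * psi s) != 0.
Proof.
move=> ac cd db delta0 eta0 psiM q0 q1 qpsi iq.
have ab : a < b by lra.
have M0 : 0 <= M.
  by apply: le_trans (psiM a _); rewrite ?normr_ge0// in_itv/= lexx ltW.
pose A := delta * eta * (d - c).
have A0 : 0 < A by rewrite !mulr_gt0// subr_gt0.
pose n := Num.bound (M * (b - a) / A).
have nA : M * (b - a) < n%:R * A.
  rewrite -ltr_pdivrMr//; apply: le_lt_trans (archi_boundP _) => //.
  by rewrite divr_ge0 ?mulr_ge0 ?subr_ge0 ?(ltW ab)// ltW.
exists n; rewrite gt_eqF//.
pose K := n%:R * eta * delta.
have iind1 : mu.-integrable `[a, b] (EFin \o \1_(`[c, d] : set R)).
  by apply: integrableS (integrable_indic_itv c d true false).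
have iind : mu.-integrable `[a, b] (fun s => (K * \1_(`[c, d]) s)%:E).
  by apply: (@integrableZl _ _ _ mu _ (measurable_itv _) K (EFin \o \1_`[c, d])).
have icst : mu.-integrable `[a, b] (fun s => M%:E).
  by apply: continuous_compact_integrable;
    [exact: segment_compact|apply: continuous_subspaceT => ?; exact: cvg_cst].
have bern m : 1 + m%:R * eta <= (1 + eta) ^+ m.
  elim: m => [|m ihm]; first by rewrite mul0r addr0 expr0.
  rewrite exprS -natr1; apply: (@le_trans _ _ ((1 + eta) * (1 + m%:R * eta))).
    rewrite -subr_ge0 (_ : _ - _ = m%:R * eta ^+ 2); last by ring.
    by rewrite mulr_ge0 ?sqr_ge0.
  by rewrite ler_wpM2l// addr_ge0// ltW.
(* The minorant is n * eta * delta - M on the peak and - M elsewhere. *)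
apply: (@lt_le_trans _ _ (\int[mu]_(s in `[a, b]) (K * \1_(`[c, d]) s - M))).
  rewrite RintegralB// RintegralZl//.
  rewrite Rintegral_cst// /Rintegral integral_indic// setIidl; last first.
    by move=> s /=; rewrite !in_itv/= => /andP[? ?]; apply/andP; split; lra.
  rewrite /= !lebesgue_measure_itv/= !lte_fin cd ab -!EFinB/= subr_gt0.
  by apply: (lt_le_trans nA); rewrite /A /K; lra.
apply: le_Rintegral => //; [|exact: iq|].
  rewrite (_ : EFin \o _ = (fun s => (K * \1_(`[c, d]) s)%:E - M%:E)%E)//.
  exact: integrableB.
move=> s /= sab; rewrite indicE.
have qn0 : 0 <= q s ^+ n by rewrite exprn_ge0// q0.
have psiNM : - M <= psi s by have := psiM _ sab; rewrite ler_norml => /andP[].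
have [|_] := boolP (s \in `[c, d]%classic).
  rewrite inE/= => scd; have [qs ps] := qpsi _ scd.
  rewrite mulr1; apply: (@le_trans _ _ ((1 + n%:R * eta) * delta)).
    by rewrite /K mulrDl; lra.
  apply: ler_pM => //; [by rewrite addr_ge0// mulr_ge0// ltW|exact: ltW|].
  by apply: (le_trans (bern n)); rewrite lerXn2r// nnegrE ?q0// addr_ge0// ltW.
rewrite mulr0 sub0r; have [qs|ps] := q1 _ sab.
  have qn1 : q s ^+ n <= 1 by rewrite exprn_ile1// q0.
  have [ps|ps] := leP 0 (psi s).
    by rewrite (@le_trans _ _ 0)// ?oppr_le0// mulr_ge0.
  apply: (le_trans psiNM); rewrite -subr_ge0.
  rewrite (_ : _ - _ = (1 - q s ^+ n) * - psi s); last by ring.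
  by rewrite mulr_ge0 ?subr_ge0 ?oppr_ge0// ltW.
by rewrite (@le_trans _ _ 0)// ?oppr_le0// mulr_ge0.
Qed.

End moments.

(** * Functions orthogonal to all the translated kernels *)

Section uniqueness.
Context {R : realType}.
Local Notation mu := (@lebesgue_measure R).
Implicit Types (a b c d x beta : R) (f : R -> R).

(** The Landau kernel [(s - c) * (d - s)], divided by [(x - s) ^+ 2] to become a
    polynomial in [(x - s)^-1].  As [x - s >= 1], dividing by [(b - a) ^+ 2] as
    well keeps the negative part of the bump above [-1]. *)
Lemma bump_peak a b c d x (s : R) : a < b -> a <= c -> c < d -> d <= b ->
  b + 1 = x -> a <= s <= b ->
  let k := ((b - a) ^+ 2)^-1 in
  let q := 1 + k * ((s - c) * (d - s) / (x - s) ^+ 2) in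
  [/\ 0 <= q, q <= 1 \/ c <= s <= d &
    c + (d - c) / 3 <= s <= d - (d - c) / 3 ->
    1 + k * (2 / 9 * (d - c) ^+ 2 / (x - a) ^+ 2) <= q].
Proof.
move=> ab ac cd db bx /andP[sa sb] k q.
have ba2 : 0 < (b - a) ^+ 2 by rewrite exprn_gt0// subr_gt0.
have k0 : 0 < k by rewrite invr_gt0.
have kba : k * (b - a) ^+ 2 = 1 by rewrite mulVf// gt_eqF.
have xs1 : 1 <= x - s by lra.
have xs2 : 1 <= (x - s) ^+ 2 by rewrite exprn_ege1.
have xs0 : 0 < (x - s) ^+ 2 by exact: lt_le_trans xs2.
split.
- rewrite /q -(mulVf (lt0r_neq0 ba2)) -/k -mulrDr mulr_ge0 ?(ltW k0)//.
  have w1 : ((x - s) ^+ 2)^-1 <= 1 by rewrite invf_le1.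
  have w0 : 0 <= ((x - s) ^+ 2)^-1 by rewrite invr_ge0 ltW.
  have m : - (b - a) ^+ 2 <= (s - c) * (d - s) by nra.
  have ba20 := ltW ba2.
  move: ((x - s) ^+ 2)^-1 ((s - c) * (d - s)) ((b - a) ^+ 2) w0 w1 m ba20.
  by clear => w m B *; nra.
- have [cs|sc] := leP c s; last first.
    left; rewrite /q gerDl pmulr_rle0// mulr_le0_ge0 ?invr_ge0 ?(ltW xs0)//.
    by rewrite nmulr_rle0; lra.
  have [sd|ds] := leP s d; first by right.
  left; rewrite /q gerDl pmulr_rle0// mulr_le0_ge0 ?invr_ge0 ?(ltW xs0)//.
  by rewrite mulr_ge0_le0; lra.
- move=> /andP[s1 s2]; rewrite /q lerD2l ler_pM2l//.
  have xa0 : 0 < (x - a) ^+ 2 by rewrite exprn_gt0//; lra.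
  apply: ler_pM => //.
  + by rewrite mulr_ge0// sqr_ge0.
  + by rewrite invr_ge0 ltW.
  + by nra.
  + by rewrite lef_pV2 ?posrE// lerXn2r ?nnegrE; lra.
Qed.

(** Near a point where [f > 0], the powers of the bump of [bump_peak] would make
    the integrals of [kernel_integral0_poly] nonzero. *)
Lemma kernel_integral0_le0 a b beta f : a < b -> beta < 0 -> continuous f ->
  (forall x, b < x -> \int[mu]_(s in `[a, b]) ((x - s) `^ beta * f s) = 0) ->
  forall s, s \in `[a, b] -> f s <= 0.
Proof.
move=> ab beta0 cf int0 s0 /[!in_itv]/= /andP[as0 s0b].
rewrite leNgt; apply/negP => f0.
have [e e0 fe] : exists2 e : R, 0 < e & forall s, `|s0 - s| < e -> f s0 / 2 <= f s.
  have /cvgrPdist_lt/(_ (f s0 / 2)) := cf s0.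
  rewrite divr_gt0// => /(_ isT)/nbhs_ballP[e /= e0 fe]; exists e => // s ss.
  have := fe s ss; rewrite /= ltr_norml => /andP[_]; lra.
pose c := Num.max a (s0 - e / 2); pose d := Num.min b (s0 + e / 2).
have cd : c < d.
  by rewrite gt_max !lt_min; apply/andP; split; apply/andP; split; lra.
have ac : a <= c by rewrite le_max lexx.
have db : d <= b by rewrite ge_min lexx.
have fcd s : c <= s <= d -> f s0 / 2 <= f s.
  rewrite ge_max le_min => /andP[/andP[_ h1] /andP[_ h2]].
  by apply: fe; rewrite ltr_norml; apply/andP; split; lra.
pose x := b + 1.
have bx : b < x by rewrite ltrDl.
pose k := ((b - a) ^+ 2)^-1.
(* s - c = (x - c) - (x - s), so that (s - c) / (x - s) is affine in
   (x - s)^-1, and likewise for d. *)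
pose P : {poly R} :=
  1 + k%:P * (((x - c)%:P * 'X - 1) * (1 - (x - d)%:P * 'X)).
pose q (s : R) := P.[(x - s)^-1].
have qE s : s \in `[a, b] -> q s = 1 + k * ((s - c) * (d - s) / (x - s) ^+ 2).
  rewrite in_itv/= => /andP[_ sb].
  rewrite /q /P !hornerE /=; field.
  by rewrite subr_eq0 gt_eqF// (le_lt_trans sb).
pose psi s := (x - s) `^ beta * f s.
have powP n : mu.-integrable `[a, b] (fun s => (q s ^+ n * psi s)%:E) /\
    \int[mu]_(s in `[a, b]) (q s ^+ n * psi s) = 0.
  have := kernel_integral0_poly bx cf
    (fun m => kernel_integral0_powers beta0 cf int0 m bx) (P ^+ n) 0.
  rewrite subr0.
  have -> : (fun s => ((P ^+ n).[(x - s)^-1] * ((x - s) `^ beta * f s))%:E)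
      = (fun s => (q s ^+ n * psi s)%:E).
    by apply/funext => s; rewrite horner_exp.
  by under eq_Rintegral do rewrite horner_exp.
have [M _ psiM] := segment_bounded (@within_continuous_kernel R a b x beta f bx cf).
pose eta := k * (2 / 9 * (d - c) ^+ 2 / (x - a) ^+ 2).
have eta0 : 0 < eta.
  rewrite !mulr_gt0 ?invr_gt0 ?exprn_gt0 ?subr_gt0//.
  exact: lt_trans bx.
pose delta := (x - a) `^ beta * (f s0 / 2).
have xa : 0 < x - a by rewrite subr_gt0 (lt_trans ab).
have delta0 : 0 < delta by rewrite mulr_gt0 ?powR_gt0 ?divr_gt0.
have psicd s : c <= s <= d -> delta <= psi s.
  move=> scd; have := fcd _ scd; move: scd => /andP[cs sd] fs.
  rewrite ler_pM ?powR_ge0 ?divr_ge0 ?(ltW f0)//; apply: powR_anti => //.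
  - exact: ltW.
  - by rewrite subr_gt0 (le_lt_trans sd)// (le_lt_trans db).
  - by rewrite lerD2l lerN2 (le_trans ac).
have peak s : s \in `[a, b] -> _ := fun sab => bump_peak ab ac cd db erefl sab.
have [n] : exists n, \int[mu]_(s in `[a, b]) (q s ^+ n * psi s) != 0.
  apply: (@peak_integral_neq0 _ a b (c + (d - c) / 3) (d - (d - c) / 3)
     q psi delta eta M) => //.
  - lra.
  - lra.
  - lra.
  - by move=> s sab; rewrite qE//; have [] := peak _ sab.
  - move=> s sab; rewrite qE//; have [_ [q1|scd] _] := peak _ sab; first by left.
    by right; apply: le_trans (ltW delta0) (psicd _ scd).
  - move=> s; rewrite in_itv/= => scd.
    have sab : s \in `[a, b].
      by rewrite in_itv/=; move: scd => /andP[? ?]; apply/andP; split; lra.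
    split; first by rewrite qE//; have [_ _] := peak _ sab; apply.
    by apply: psicd; move: scd => /andP[? ?]; apply/andP; split; lra.
  - by move=> n; have [] := powP n.
by have [_ ->] := powP n; rewrite eqxx.
Qed.

Lemma kernel_integral0_eq0 a b beta f : a < b -> beta < 0 -> continuous f ->
  (forall x, b < x -> \int[mu]_(s in `[a, b]) ((x - s) `^ beta * f s) = 0) ->
  forall s, s \in `[a, b] -> f s = 0.
Proof.
move=> ab beta0 cf int0 s sab; apply/le_anti/andP; split.
  exact: (kernel_integral0_le0 ab beta0 cf int0).
rewrite -oppr_le0; apply: (kernel_integral0_le0 (f := \- f) ab beta0) => //.
  by move=> y; apply: cvgN; exact: cf.
move=> x bx.
under eq_Rintegral do rewrite mulrN -mulN1r.
by rewrite RintegralZl ?int0 ?mulr0//; exact: integrable_kernel.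
Qed.

End uniqueness.

(** * The main theorem *)

Lemma periodic_representative (R : realType) (f : R -> R) (T t : R) :
  0 < T -> periodic f T -> exists2 s, s \in `[0, T] & f s = f t.
Proof.
move=> T0 fT.
pose n := Num.bound (- t / T).
pose u := t + T *+ n.
have u0 : 0 <= u.
  have : - t <= n%:R * T.
    rewrite -ler_pdivrMr//; have [h|h] := leP 0 (- t / T).
      exact/ltW/archi_boundP.
    by rewrite (le_trans (ltW h)).
  by rewrite /u -mulr_natl; lra.
pose k := Num.truncn (u / T).
have /andP[k1 k2] : k%:R <= u / T < k.+1%:R.
  by apply: truncn_itv; rewrite divr_ge0// ltW.
exists (u - T *+ k).
  move: k1 k2; rewrite ler_pdivlMr// ltr_pdivrMr// -natr1 mulrDl mul1r => k1 k2.
  by rewrite in_itv/= -mulr_natl; apply/andP; split; lra.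
by rewrite -(periodicn fT k) subrK /u periodicn.
Qed.

Theorem theorem9 (R : realType) (f : R -> R) (T alpha : R)
  (f_cont : continuous f)
  (T_gt0 : 0 < T) (f_per : periodic f T)
  (f_neq0 : exists t : R, f t != 0)
  (alpha_gt0 : 0 < alpha) (alpha_lt1 : alpha < 1)
  (If_bounded : [bounded frac_int alpha f t | t in `]0, +oo[]) :
  ~ exists g : R -> R,
      almost_periodic g /\ (forall t : R, 0 < t -> g t = frac_int alpha f t).
Proof.
case=> g [apg gE].
have gT : forall t, g (t + T) = g t.
  apply: almost_periodic_shift_eq => // eps eps0.
  have [M FM] :=
    frac_int_shiftB_small f_cont T_gt0 f_per alpha_gt0 alpha_lt1 eps0.
  exists (Num.max M 1) => t; rewrite ge_max => /andP[Mt t1].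
  have t0 : 0 < t by rewrite (lt_le_trans _ t1).
  by rewrite !gE ?addr_gt0//; exact: FM.
have int0 x : T < x ->
    \int[lebesgue_measure]_(s in `[0, T]) ((x - s) `^ (alpha - 1) * f s) = 0.
  move=> Tx; have xT0 : 0 < x - T by rewrite subr_gt0.
  have := frac_int_shiftB f_cont T_gt0 f_per alpha_gt0 xT0.
  rewrite -!gE ?(addr_gt0 xT0 T_gt0)// gT subrr subrK.
  move/esym/eqP; rewrite mulf_eq0 invr_eq0 gt_eqF ?Gamma_gt0//=.
  by move/eqP.
have [t /eqP] := f_neq0.
have [s sT <-] := periodic_representative t T_gt0 f_per.
apply; apply: (kernel_integral0_eq0 T_gt0 _ f_cont int0 sT).
by rewrite subr_lt0.
Qed.
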